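(* Let $X$ be a real finite dimensional Hilbert space, let $\alpha\in(0,1)$, let $T:X\to X$ be $\alpha$-averaged, let $0\leq\alpha_k\leq(1-\alpha)/\alpha$ for all $k$, and let the sequence $(x_k)$ (with auxiliary sequence $(\bar x_k)$) be defined from $x_0\in X$ by $$x_{k+1}=T\bar x_k,\qquad \bar x_k=\begin{cases}x_k&\text{if }k\text{ is even},\\ x_k+\alpha_k(x_k-x_{k-1})&\text{if }k\text{ is odd}.\end{cases}$$ Let $x^*\in\mathrm{Fix}\,T$ and $b\geq\max\{\|x_0-x^*\|,\|x_1-x^*\|\}$. Let $\rho$ be a modulus of regularity for $T$ w.r.t. $\mathrm{Fix}\,T$ and $\overline B(x^*,b)$. Then $(x_n)$ is Cauchy with $$\forall\delta>0\ \forall n,m\geq\max\left\{3,\ 2\left\lceil\frac{\alpha}{1-\alpha}b^2\left(\left\lceil\frac{1}{\rho\left(\frac\delta4\right)}\right\rceil+1\right)^2\right\rceil\right\}\ \big(\|x_n-x_m\|<\delta\big).$$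
   Context: $\mathrm{Fix}\,T=\{x\in X\mid Tx=x\}$. $T$ is $\alpha$-averaged if $(1-\alpha)\|(Id-T)x-(Id-T)y\|^2\leq\alpha\big(\|x-y\|^2-\|Tx-Ty\|^2\big)$ for all $x,y\in X$. For $S\subseteq X$, a function $\rho:(0,\infty)\to(0,\infty)$ is a modulus of regularity for $T$ w.r.t. $\mathrm{Fix}\,T$ and $S$ if for all $\varepsilon>0$ and $x\in S$: $\|x-Tx\|<\rho(\varepsilon)$ implies $\mathrm{dist}(x,\mathrm{Fix}\,T)<\varepsilon$. $\overline B(x^*,b)$ is the closed ball. *)

(* Defs.v *)
From HB Require Import structures.
From mathcomp Require Import all_boot all_order all_algebra.
From mathcomp Require Import all_classical all_reals all_analysis.

Set Implicit Arguments.
Unset Strict Implicit.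
Unset Printing Implicit Defensive.

Import Order.TTheory GRing.Theory Num.Theory.
Import numFieldNormedType.Exports.

Local Open Scope classical_set_scope.
Local Open Scope ring_scope.

(* Over the reals, [{dot X for idfun}] is the type of positive definite
   symmetric bilinear forms on X. *)
HB.mixin Record isHilbert (R : realType) X
    of CompleteNormedModule R X := {
  inner : {dot X for idfun};
  normr_inner : forall x : X, `|x| = Num.sqrt (inner x x)
}.

#[short(type="hilbertType")]
HB.structure Definition Hilbert (R : realType) :=
  {X of CompleteNormedModule R X & isHilbert R X}.

#[short(type="finDimHilbertType")]
HB.structure Definition FinDimHilbert (R : realType) :=
  {X of Hilbert R X & Vector R X}.

Section Definitions.
Context {R : realType} {X : normedModType R}.
Implicit Types (x : X) (A S : set X) (T : X -> X) (rho : R -> R).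

Definition Fix T : set X := [set x | T x = x].

Definition averaged (alpha : R) T : Prop := forall x y,
  (1 - alpha) * `|(x - T x) - (y - T y)| ^+ 2
    <= alpha * (`|x - y| ^+ 2 - `|T x - T y| ^+ 2).

(* [inf] takes the junk value 0 on the empty set: only meaningful for
   nonempty A. *)
Definition dist x A : R := inf [set `|x - y| | y in A].

(* A function (0, oo) -> (0, oo) is encoded as a function on R that is
   positive at positive arguments; its other values are irrelevant. *)
Definition modulus_of_regularity rho T S : Prop :=
  (forall eps, 0 < eps -> 0 < rho eps) /\
  (forall eps x, 0 < eps -> S x ->
     `|x - T x| < rho eps -> dist x (Fix T) < eps).

(* The library's [closed_ball x b] is a closure of an open ball, hence empty
   for b = 0, while [closed_ball_] is the metric closed ball for all b. *)
Definition cball x (b : R) : set X := closed_ball_ Num.norm x b.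

End Definitions.

(* Main.v *)
Require Import Defs.
From mathcomp Require Import all_boot all_order all_algebra.
From mathcomp Require Import all_classical all_reals all_analysis.
From mathcomp Require Import ring lra zify.
Import Order.TTheory GRing.Theory Num.Theory.
Import numFieldNormedType.Exports.
Local Open Scope classical_set_scope.
Local Open Scope ring_scope.

(** Put c = (1 - alpha) / alpha. For a fixed point p of T, averagedness says
    that one application of T lowers the squared distance to p by at least c
    times the squared residual (averaged_fix). Look at an even iterate
    u = x_2k, at v = T u = x_(2k+1) and at the extrapolated point
    w = v + a (v - u) = xbar_(2k+1). Expanding the inner product,

      |w - p|^2 = |v - p|^2 + a (|v - p|^2 - |u - p|^2)
                  + a (1 + a) |u - v|^2,

    so the gain c |u - v|^2 made in passing from u to v pays for the
    extrapolation as soon as a <= c, and |w - p| <= |u - p|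
    (extrapolation_le). Hence the even iterates are Fejer monotone with respect
    to Fix T, each odd iterate is no farther from p than its predecessor, and
    every extrapolated point w_k stays in the ball of radius b around xstar.

    The second application of T gives
    |x_(2k+2) - p|^2 + c |w_k - T w_k|^2 <= |x_2k - p|^2. Telescoping with
    p = xstar, the residuals of w_0, ..., w_(J-1) cannot all be at least r
    once c J r^2 > b^2 (telescope_small_residual). With r = rho (delta / 4)
    and J the ceiling in the stated bound this yields j < J for which w_j is
    within delta / 4 of some fixed point p. Fejer monotonicity with respect to
    this p keeps all x_n with n >= 2 j + 2 within delta / 4 of p, hence within
    delta / 2 of one another. When b = 0 the count of steps may degenerate to
    J = 0, but then the sequence is constantly xstar. *)

(** * Norm identities and averaged maps *)

Lemma sqr_normrDZ (R : realType) (X : hilbertType R) (u v : X) (t : R) :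
  `|u + t *: v| ^+ 2 = `|u| ^+ 2 + 2 * t * inner u v + t ^+ 2 * `|v| ^+ 2.
Proof.
have normE (z : X) : `|z| ^+ 2 = inner z z.
  rewrite normr_inner sqr_sqrtr //; have [->|z0] := eqVneq z 0.
    by rewrite linear0r.
  exact/ltW/neq0_dnorm_gt0.
have innerC : inner v u = inner u v :> R by rewrite hermC expr0 mul1r.
have innerZl (z w : X) : inner (t *: z) w = t * inner z w :> R.
  by rewrite linearZl_LR.
have innerZr (z w : X) : inner z (t *: w) = t * inner z w :> R.
  by rewrite linearZr_LR.
rewrite !normE linearDl !linearDr /= !(innerZl, innerZr) innerC; ring.
Qed.

(** The extrapolation step costs at most what the preceding averaged step,
    recorded in the first hypothesis, has gained. *)
Lemma extrapolation_le (R : realType) (X : hilbertType R) (u v p : X)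
    (c t : R) :
  `|v - p| ^+ 2 + c * `|u - v| ^+ 2 <= `|u - p| ^+ 2 -> 0 <= t <= c ->
  `|v + t *: (v - u) - p| <= `|u - p|.
Proof.
move=> gain /andP[t_ge0 t_le_c].
rewrite -ler_sqr ?nnegrE ?normr_ge0 //.
(* Expanding both u = v - d and w = v + t d, with d = v - u, along the line
   through v lets the cross term inner (v - p) d be eliminated. *)
have uE : u - p = (v - p) + (-1) *: (v - u).
  by rewrite scaleN1r opprB [RHS]addrC addrA subrK.
have wE : v + t *: (v - u) - p = (v - p) + t *: (v - u) by rewrite addrAC.
have := sqr_normrDZ R X (v - p) (v - u) (-1).
have := sqr_normrDZ R X (v - p) (v - u) t.
rewrite -uE -wE => -> uexp; rewrite uexp; rewrite uexp (distrC u v) in gain.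
move: (inner _ _) (`|_| ^+ 2) (`|v - u| ^+ 2) (sqr_ge0 `|v - u|) gain.
move=> i A D D_ge0 gain.
have le_i : 2 * i <= (1 - t) * D.
  have : 0 <= (c - t) * D by rewrite mulr_ge0 // subr_ge0.
  by lra.
have : 0 <= (1 + t) * ((1 - t) * D - 2 * i).
  by apply: mulr_ge0; [exact: addr_ge0 | rewrite subr_ge0].
lra.
Qed.

Lemma averaged_fix (R : realType) (X : normedModType R) (alpha : R)
    (T : X -> X) (p z : X) :
  0 < alpha -> averaged alpha T -> Fix T p ->
  `|T z - p| ^+ 2 + (1 - alpha) / alpha * `|z - T z| ^+ 2 <= `|z - p| ^+ 2.
Proof.
move=> alpha_gt0 /(_ z p) + Tp; rewrite Tp subrr subr0 => le_z.
rewrite -(ler_pM2l alpha_gt0) mulrDr [alpha * (_ / _ * _)]mulrA.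
rewrite [alpha * (_ / _)]mulrC divfK ?gt_eqF //; lra.
Qed.

(** * Counting steps *)

(** The quantitative form of the fact that a summable sequence of squares tends
    to zero: either some early residual is small, or the potential d has
    decreased by an amount proportional to the number of steps. *)
Lemma telescope_small_residual (R : realType) (c r : R) (d e : nat -> R) :
  0 <= c -> 0 <= r -> (forall k, d k.+1 + c * e k ^+ 2 <= d k) ->
  forall J, (exists2 j, (j < J)%N & e j < r) \/ d J + c * J%:R * r ^+ 2 <= d 0%N.
Proof.
move=> c_ge0 r_ge0 dS; elim=> [|J [[j jJ ej]|IH]].
- by right; rewrite mulr0 mul0r addr0.
- by left; exists j => //; exact: ltnW.
have [eJ|r_le] := ltP (e J) r; first by left; exists J.
right; have : c * r ^+ 2 <= c * e J ^+ 2.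
  by rewrite ler_wpM2l // ler_sqr ?nnegrE // (le_trans r_ge0).
by have := dS J; rewrite -natr1; lra.
Qed.

(** The number of steps is large enough to exceed the budget b ^ 2; the +1
    after the inner ceiling makes the comparison strict. *)
Lemma ceil_step_count (R : realType) (c b r : R) (J : nat) :
  0 < c -> 0 < b -> 0 < r ->
  c^-1 * b ^+ 2 * (Num.ceil (1 / r) + 1)%:~R ^+ 2 <= J%:R ->
  b ^+ 2 < c * J%:R * r ^+ 2.
Proof.
move=> c_gt0 b_gt0 r_gt0; set q := (_%:~R) => le_J.
have qr_gt1 : 1 < (q * r) ^+ 2.
  rewrite exprn_egt1 // -ltr_pdivrMr // /q rmorphD /=.
  by rewrite (le_lt_trans (ceil_ge _)) // ltrDl.
have : b ^+ 2 * q ^+ 2 <= c * J%:R.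
  rewrite -(ler_pM2l c_gt0) in le_J; apply: le_trans le_J.
  by rewrite !mulrA divff ?gt_eqF // mul1r.
move/(ler_wpM2r (sqr_ge0 r)); apply: lt_le_trans.
by rewrite -mulrA -exprMn ltr_pMr // exprn_gt0.
Qed.

(** * The alternating inertial iteration *)

Section Iteration.
Context (R : realType) (X : hilbertType R) (alpha : R) (T : X -> X).
Context (a : nat -> R) (x xbar : nat -> X).
Context (alpha_gt0 : 0 < alpha) (T_averaged : averaged alpha T).
Context (a_bound : forall k, 0 <= a k <= (1 - alpha) / alpha).
Context (xS : forall k, x k.+1 = T (xbar k)).
Context (xbarE : forall k, xbar k =
  if odd k then x k + a k *: (x k - x k.-1) else x k).

Local Notation c := ((1 - alpha) / alpha).

Let c_ge0 : 0 <= c.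
Proof. by have /andP[/le_trans h /h] := a_bound 0. Qed.

Let x_odd k : x k.*2.+1 = T (x k.*2).
Proof. by rewrite xS xbarE odd_double. Qed.

Lemma iterate_le p z : Fix T p -> `|T z - p| <= `|z - p|.
Proof.
move=> Tp; rewrite -ler_sqr ?nnegrE ?normr_ge0 //.
apply: le_trans (averaged_fix R X alpha T p z alpha_gt0 T_averaged Tp).
by rewrite lerDl mulr_ge0 ?sqr_ge0.
Qed.

Lemma xbar_odd_le p k : Fix T p -> `|xbar k.*2.+1 - p| <= `|x k.*2 - p|.
Proof.
move=> Tp; rewrite xbarE /= odd_double /=.
apply: extrapolation_le (a_bound _); rewrite x_odd.
exact: averaged_fix.
Qed.

Lemma even_decrease p k : Fix T p ->
  `|x k.+1.*2 - p| ^+ 2 + c * `|xbar k.*2.+1 - T (xbar k.*2.+1)| ^+ 2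
    <= `|x k.*2 - p| ^+ 2.
Proof.
move=> Tp; rewrite doubleS xS.
apply: le_trans (averaged_fix R X alpha T p _ alpha_gt0 T_averaged Tp) _.
by rewrite ler_sqr ?nnegrE ?normr_ge0 // xbar_odd_le.
Qed.

(** Two mechanisms combine: the even iterates decrease by the extrapolation
    estimate, and an odd iterate is a plain application of T, which is
    nonexpansive towards p, to its even predecessor. *)
Lemma fejer_even p k n : Fix T p -> (k.*2 <= n)%N ->
  `|x n - p| <= `|x k.*2 - p|.
Proof.
move=> Tp le_kn.
have /nonincreasing_seqP mono m : `|x m.+1.*2 - p| <= `|x m.*2 - p|.
  by rewrite doubleS xS (le_trans (iterate_le _ _ Tp)) // xbar_odd_le.
have half_le : `|x (n./2).*2 - p| <= `|x k.*2 - p|.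
  by apply: mono; rewrite -(doubleK k) half_leq.
apply: le_trans half_le; rewrite -{1}(odd_double_half n).
by case: (odd n); rewrite ?add0n // add1n x_odd iterate_le.
Qed.

Lemma fejer_xbar p k n : Fix T p -> (k.+1.*2 <= n)%N ->
  `|x n - p| <= `|xbar k.*2.+1 - p|.
Proof.
move=> Tp /(fejer_even _ _ _ Tp) /le_trans; apply.
by rewrite doubleS xS iterate_le.
Qed.

Context (xstar : X) (b : R) (rho : R -> R) (alpha_lt1 : alpha < 1).
Context (xstar_fix : Fix T xstar) (x0_bound : `|x 0%N - xstar| <= b).
Context (rho_modulus : modulus_of_regularity rho T (cball xstar b)).

(** Regularity is applied at the extrapolated points and not at the iterates:
    theirs are the residuals that the telescoping controls, and they too lie in
    the ball on which rho is a modulus. *)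
Lemma xbar_near_fix eps J : 0 < b -> 0 < eps ->
  c^-1 * b ^+ 2 * (Num.ceil (1 / rho eps) + 1)%:~R ^+ 2 <= J%:R ->
  exists2 j, (j < J)%N & exists2 p, Fix T p & `|xbar j.*2.+1 - p| < eps.
Proof.
move=> b_gt0 eps_gt0; have [rho_gt0 reg] := rho_modulus.
have r_gt0 := rho_gt0 _ eps_gt0.
have c_gt0 : 0 < c by rewrite divr_gt0 // subr_gt0.
move=> /(ceil_step_count _ _ _ _ _ c_gt0 b_gt0 r_gt0) lt_b.
have [[j jJ small]|big] := telescope_small_residual R c (rho eps)
    (fun k => `|x k.*2 - xstar| ^+ 2) _ c_ge0 (ltW r_gt0)
    (fun k => even_decrease xstar k xstar_fix) J; last first.
  have : `|x 0%N - xstar| ^+ 2 <= b ^+ 2.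
    by rewrite ler_sqr ?nnegrE ?normr_ge0 // ltW.
  by have := sqr_ge0 `|x J.*2 - xstar|; move: big; rewrite double0; lra.
exists j => //.
have in_ball : cball xstar b (xbar j.*2.+1).
  rewrite /cball /closed_ball_ /= distrC (le_trans (xbar_odd_le _ _ xstar_fix)) //.
  by apply: le_trans x0_bound; exact: (fejer_even xstar 0).
have /inf_lt[|_ [p Tp <-] lt_eps] := reg _ _ eps_gt0 in_ball small.
  by exists `|xbar j.*2.+1 - xstar|, xstar.
by exists p.
Qed.

Lemma iterates_close delta n m : 0 < delta ->
  let N : int := 2 * Num.ceil (c^-1 * b ^+ 2 *
    (Num.ceil (1 / rho (delta / 4)) + 1)%:~R ^+ 2) in
  N <= n%:Z -> N <= m%:Z -> `|x n - x m| < delta.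
Proof.
move=> delta_gt0; set K := Num.ceil _ => N len lem.
(* For b = 0 the ceiling K is 0, so no step is available to search. *)
have [b_le0|b_gt0] := leP b 0.
  have xE k : x k = xstar.
    apply/eqP; rewrite -subr_eq0 -normr_le0; apply: le_trans b_le0.
    by apply: le_trans x0_bound; exact: (fejer_even xstar 0).
  by rewrite !xE subrr normr0.
have d4_gt0 : 0 < delta / 4 by rewrite divr_gt0.
have [j jJ [p Tp near_p]] : exists2 j, (j < `|K|)%N &
    exists2 p, Fix T p & `|xbar j.*2.+1 - p| < delta / 4.
  apply: xbar_near_fix => //; rewrite (le_trans (ceil_ge _)) // -/K.
  by rewrite natr_absz ler_int ler_norm.
have K_ge0 : 0 <= K.
  rewrite ceil_ge0 (lt_le_trans (ltrN10 R)) //.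
  by rewrite mulr_ge0 ?sqr_ge0 // mulr_ge0 ?sqr_ge0 // invr_ge0.
(* j < K gives 2 (j + 1) <= 2 K = N. *)
have close k : N <= k%:Z -> `|x k - p| < delta / 4.
  move=> lek; apply: le_lt_trans near_p; apply: fejer_xbar => //.
  by move: lek; rewrite /N; lia.
rewrite (le_lt_trans (ler_distD p _ _)) // (distrC p).
by have := close n len; have := close m lem; lra.
Qed.

End Iteration.

Theorem theorem7p12 (R : realType) (X : finDimHilbertType R)
    (alpha : R) (T : X -> X) (a : nat -> R) (x xbar : nat -> X)
    (xstar : X) (b : R) (rho : R -> R)
    (alpha_gt0 : 0 < alpha) (alpha_lt1 : alpha < 1)
    (T_averaged : averaged alpha T)
    (a_bound : forall k, 0 <= a k <= (1 - alpha) / alpha)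
    (xS : forall k, x k.+1 = T (xbar k))
    (xbarE : forall k, xbar k =
       if odd k then x k + a k *: (x k - x k.-1) else x k)
    (xstar_fix : Fix T xstar)
    (b_bound : Num.max `|x 0%N - xstar| `|x 1%N - xstar| <= b)
    (rho_modulus : modulus_of_regularity rho T (cball xstar b)) :
  cauchy (x @ \oo) /\
  forall delta : R, 0 < delta -> forall n m : nat,
    let N : int := Num.max 3 (2 * Num.ceil (alpha / (1 - alpha) * b ^+ 2 *
      ((Num.ceil (1 / rho (delta / 4)) + 1)%:~R) ^+ 2)) in
    N <= n%:Z -> N <= m%:Z -> `|x n - x m| < delta.
Proof.
move: b_bound; rewrite ge_max => /andP[x0_bound _].
have rate (delta : R) (n m : nat) : 0 < delta ->
    let N : int := Num.max 3 (2 * Num.ceil (alpha / (1 - alpha) * b ^+ 2 *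
      ((Num.ceil (1 / rho (delta / 4)) + 1)%:~R) ^+ 2)) in
    N <= n%:Z -> N <= m%:Z -> `|x n - x m| < delta.
  move=> delta_gt0 /=; rewrite !ge_max -(invf_div (1 - alpha)).
  move=> /andP[_ len] /andP[_ lem].
  exact: (iterates_close R X alpha T a x xbar alpha_gt0 T_averaged a_bound
    xS xbarE xstar b rho alpha_lt1 xstar_fix x0_bound rho_modulus delta).
split; last by move=> delta delta_gt0 n m; exact: rate.
apply: cauchy_exP => eps eps_gt0.
pose N : int := Num.max 3 (2 * Num.ceil (alpha / (1 - alpha) * b ^+ 2 *
  ((Num.ceil (1 / rho (eps / 4)) + 1)%:~R) ^+ 2)).
have leN k : (`|N| <= k)%N -> N <= k%:Z by lia.
exists (x `|N|%N); exists `|N|%N => // n /= leNn.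
by rewrite -ball_normE /=; apply: rate => //; exact: leN.
Qed.
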